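(* Let $K$ be a field, let $S=K[x,y]$ be graded by $\deg(x)=\deg(y)=1$, and let $h:\mathbb Z_{\ge 0}\to\mathbb Z_{\ge 0}$ be a function with $\sum_{d\ge 0}h(d)<\infty$ such that $\mathrm{Hilb}_S^h$ is nonempty. Then for a general ideal $I$ in $\mathrm{Hilb}_S^h$ (i.e. for all $I$ in some nonempty Zariski-open subset of $\mathrm{Hilb}_S^h$), for every $d\ge 0$ the degree-$d$ matroid $\mathcal M(I_d)$ is the uniform matroid $U_{h(d),d+1}$. Furthermore, if $K$ is infinite, then $I$ can be taken to be a $K$-rational point of $\mathrm{Hilb}_S^h$; that is, there is a homogeneous ideal $I\subseteq K[x,y]$ with Hilbert function $h$ such that $\mathcal M(I_d)=U_{h(d),d+1}$ for all $d\ge 0$.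
   Context: $\mathrm{Hilb}_S^h$ is the multigraded Hilbert scheme over $K$ parametrizing homogeneous ideals of $S$ with Hilbert function $h$: for a $K$-algebra $A$, its $A$-points are the homogeneous ideals $I\subseteq A[x,y]$ such that $(A[x,y]/I)_d$ is a locally free $A$-module of rank $h(d)$ for all $d$. In particular, its $K$-rational points are the homogeneous ideals $I\subseteq K[x,y]$ with $\dim_K(S/I)_d=h(d)$ for all $d$. (It is known to be smooth and irreducible in this setting. A not necessarily $K$-rational point corresponds to an ideal in $L[x,y]$, with $L$ its residue field.) For a homogeneous ideal $I$ with Hilbert function $h$ (over a field), the degree-$d$ matroid $\mathcal M(I_d)$ is the matroid on the ground set $\mathrm{Mon}_d$ of the $d+1$ monomials of degree $d$ in $x,y$, whose circuits are the minimal (with respect to inclusion) supports of nonzero polynomials in $I_d$. Equivalently, a set $E$ of $h(d)$ monomials of degree $d$ is a basis of $\mathcal M(I_d)$ if and only if there is no nonzero polynomial in $I$ with support contained in $E$. The uniform matroid $U_{h(d),d+1}$ is the matroid on $\mathrm{Mon}_d$ in which every set of $h(d)$ monomials is a basis. *)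

(* Defs.v *)
From HB Require Import structures.
From mathcomp Require Import all_boot all_order all_algebra.
From mathcomp Require Export mpoly.

Set Implicit Arguments.
Unset Strict Implicit.
Unset Printing Implicit Defensive.

Import GRing.Theory.

Local Open Scope ring_scope.

(* Subsets of A[x,y] are Prop-valued predicates, since ideals need not be
   decidable over an arbitrary ring A. *)
Definition subset2 (A : comNzRingType) := {mpoly A[2]} -> Prop.

Definition is_ideal (A : comNzRingType) (I : subset2 A) : Prop :=
  [/\ I 0,
      forall f g, I f -> I g -> I (f + g)
    & forall f g, I g -> I (f * g)].

Definition is_homogeneous (A : comNzRingType) (I : subset2 A) : Prop :=
  forall (d : nat) f, I f -> I (pihomog mdeg d f).

(* The images of e_0, ..., e_(r-1) form a basis of the localization at s of the
   A-module (A[x,y]/I)_d. Elements of a module become equal in the localization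
   iff some power of s annihilates their difference; restricting to e_j coming
   from (A[x,y]/I)_d itself loses nothing, as s is a unit in A_s. *)
Definition localized_basis (A : comNzRingType) (I : subset2 A) (d : nat) (s : A)
    (r : nat) (e : 'I_r -> {mpoly A[2]}) : Prop :=
  [/\ forall j, e j \is d.-homog,
      forall f, f \is d.-homog ->
        exists (k : nat) (c : 'I_r -> A),
          I (s ^+ k *: f - \sum_(j < r) c j *: e j)
    & forall c : 'I_r -> A, I (\sum_(j < r) c j *: e j) ->
        exists k : nat, forall j, s ^+ k * c j = 0].

(* (A[x,y]/I)_d is locally free of rank r: Spec A is covered by basic opens
   D(s_i) over which it is free of rank r. *)
Definition locally_free_rank (A : comNzRingType) (I : subset2 A) (d r : nat)
    : Prop :=
  exists (n : nat) (s a : 'I_n -> A),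
    \sum_(i < n) a i * s i = 1 /\
    forall i, exists e : 'I_r -> {mpoly A[2]}, localized_basis I d (s i) e.

(* The A-points of Hilb_S^h. Over a field, locally free of rank h d just means
   of dimension h d, so I is then a homogeneous ideal with Hilbert function h. *)
Definition hilb_point (h : nat -> nat) (A : comNzRingType) (I : subset2 A)
    : Prop :=
  [/\ is_ideal I, is_homogeneous I & forall d, locally_free_rank I d (h d)].

(* The extension I B[x,y] of I along phi : A -> B. For an A-point I of Hilb_S^h
   this is its image in the B-points. *)
Definition extend_ideal (A B : comNzRingType) (phi : {rmorphism A -> B})
    (I : subset2 A) : subset2 B :=
  fun g => exists (n : nat) (b : 'I_n -> {mpoly B[2]}) (f : 'I_n -> {mpoly A[2]}),
    (forall i, I (f i)) /\ g = \sum_(i < n) b i * map_mpoly phi (f i).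

(* A set of points of the scheme Hilb_S^h. A point is represented by an L-point
   I, for some field extension iota : K -> L; different representatives of the
   same point (one obtained from another by extending scalars) are identified
   by hilb_open below. *)
Definition point_set (K : fieldType) :=
  forall L : fieldType, {rmorphism K -> L} -> subset2 L -> Prop.

Definition hilb_nonempty (h : nat -> nat) (K : fieldType) : Prop :=
  exists (L : fieldType) (iota : {rmorphism K -> L}) (I : subset2 L),
    hilb_point h I.

Definition point_set_nonempty (K : fieldType) (U : point_set K) : Prop :=
  exists (L : fieldType) (iota : {rmorphism K -> L}) (I : subset2 L),
    U L iota I.

(* U is Zariski-open in Hilb_S^h: for every K-algebra A and every morphism
   Spec A -> Hilb_S^h over K, i.e. every A-point I, the preimage of U in Spec A
   is the complement of V(J) for some subset J of A. A point of Spec A is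
   represented by a morphism phi : A -> L of K-algebras to a field; it is mapped
   to the L-point extend_ideal phi I, and it lies outside V(J) iff phi does not
   vanish on J. Taking A to be a field shows that membership in U is unchanged
   by extension of scalars. *)
Definition hilb_open (h : nat -> nat) (K : fieldType) (U : point_set K) : Prop :=
  (forall (L : fieldType) (iota : {rmorphism K -> L}) (I : subset2 L),
     U L iota I -> hilb_point h I) /\
  (forall (A : comNzRingType) (iotaA : {rmorphism K -> A}) (I : subset2 A),
     hilb_point h I ->
     exists J : A -> Prop,
       forall (L : fieldType) (iotaL : {rmorphism K -> L})
              (phi : {rmorphism A -> L}),
         (forall c, phi (iotaA c) = iotaL c) ->
         (U L iotaL (extend_ideal phi I) <-> exists2 a, J a & phi a != 0)).

Definition Mon (d : nat) : finType := {m : 'X_{1..2 < d.+1} | mdeg m == d}.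

Definition support_in (L : fieldType) (d : nat) (f : {mpoly L[2]})
    : {set Mon d} :=
  [set m : Mon d | (val m : 'X_{1..2}) \in msupp f].

Definition is_support (L : fieldType) (I : subset2 L) (d : nat)
    (C : {set Mon d}) : Prop :=
  exists f : {mpoly L[2]},
    [/\ I f, f \is d.-homog, f != 0 & support_in d f = C].

Definition circuit (L : fieldType) (I : subset2 L) (d : nat)
    (C : {set Mon d}) : Prop :=
  is_support I C /\
  forall D : {set Mon d}, is_support I D -> D \subset C -> D = C.

(* A matroid is determined by its circuits: the independent sets are those
   containing no circuit, and the bases are the maximal independent sets. *)
Section MatroidFromCircuits.

Variables (T : finType) (circ : {set T} -> Prop).

Definition independent (E : {set T}) : Prop :=
  forall C : {set T}, circ C -> ~~ (C \subset E).

Definition basis (E : {set T}) : Prop :=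
  independent E /\
  forall F : {set T}, independent F -> E \subset F -> F = E.

Definition uniform_matroid (r : nat) : Prop :=
  forall E : {set T}, basis E <-> #|E| = r.

End MatroidFromCircuits.

Definition all_matroids_uniform (h : nat -> nat) (L : fieldType)
    (I : subset2 L) : Prop :=
  forall d : nat, uniform_matroid (@circuit L I d) (h d).

Definition infinite_type (T : eqType) : Prop :=
  forall s : seq T, exists x, x \notin s.

(* Main.v *)
From HB Require Import structures.
Require Import Defs.
From mathcomp Require Import all_boot all_order all_algebra.
From Stdlib Require Import Classical.
Set Implicit Arguments.
Unset Strict Implicit.
Unset Printing Implicit Defensive.
Import GRing.Theory.
Local Open Scope ring_scope.

(** Over a field, write a form of degree [d] as the row [v] of its [d.+1]
coefficients. The degree-[d] part of an ideal [I] in Hilb^h is then the left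
kernel of a matrix [M] of full rank [h d] with [d.+1] rows ([presents]), and a
set of [h d] monomials is a basis of the matroid iff the corresponding maximal
minor of [M] is nonzero. So the matroid is uniform iff no maximal minor of [M]
vanishes ([uniform_matroid_minors]).

The set [U] of the theorem consists of all points whose matroids are uniform.

[U] is open. Let [I] be a point over a ring [A]. On a basic open set D(s) over
which the degree-[d] quotient is free, a single matrix [C] over [A] presents
all the base changes of [I] ([localized_basis_extend]). Uniformity in degree
[d] is therefore the nonvanishing of an element of [A], namely [s] times the
product of the maximal minors of [C]. Only the finitely many degrees with
[h d != 0] impose a condition ([uniform_locus_open]).

[U] is nonempty. If some ideal has Hilbert function [h], then for each [e]
either [h e = e.+1] or [h] never exceeds [h e] from [e] on
([hilb_point_function]): as soon as [I] contains a nonzero form of degree [d],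
multiplication by x and y makes the dimension of its graded part grow. Given
such an [h] and a scalar [t], let [I] consist of the polynomials whose
component of each degree [d] vanishes at the first [h d] of the points
(1 : 1), (t : 1), (t^2 : 1), ... Because [h] does not increase once it drops
below [d.+1], this is an ideal. Its degree-[d] part is presented by the matrix
with entries (t^i)^j, whose maximal minors are Vandermonde determinants in the
distinct powers of [t] chosen by the rows. Hence it is a point of [U] as soon
as the first powers of [t] are distinct: such a [t] exists in an infinite [K],
and over any [K] the variable of the field K(X) will do. *)

(** * Binary forms in coordinates *)

Section Coordinates.
Variable R : comNzRingType.
Implicit Types (f g : {mpoly R[2]}) (d : nat).

(** The monomial x^i y^(d-i). *)
Definition mon d (i : 'I_d.+1) : 'X_{1..2} :=
  [multinom (if k == ord0 then i : nat else (d - i)%N) | k < 2].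

Lemma mdeg2 (m : 'X_{1..2}) : mdeg m = (m ord0 + m ord_max)%N.
Proof.
rewrite mdegE big_ord_recr big_ord1 /=.
by congr (m _ + m _)%N; apply: val_inj.
Qed.

Lemma mdeg_mon d (i : 'I_d.+1) : mdeg (mon i) = d.
Proof. by rewrite mdeg2 !mnmE /= subnKC // -ltnS. Qed.

Lemma mnm2P (m m' : 'X_{1..2}) :
  mdeg m = mdeg m' -> m ord0 = m' ord0 -> m = m'.
Proof.
rewrite !mdeg2 => + e0; rewrite e0 => /addnI e1; apply/mnmP=> -[[|[|//]] lt].
  by rewrite (_ : Ordinal lt = ord0) //; apply: val_inj.
by rewrite (_ : Ordinal lt = ord_max) //; apply: val_inj.
Qed.

Lemma mon_inj d : injective (@mon d).
Proof. by move=> i j /mnmP/(_ ord0); rewrite !mnmE /= => /val_inj. Qed.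

Definition exp0 d (m : 'X_{1..2}) : 'I_d.+1 := inord (m ord0).

Lemma exp0K d (m : 'X_{1..2}) : mdeg m = d -> mon (exp0 d m) = m.
Proof.
move=> dm; apply: mnm2P; first by rewrite mdeg_mon.
by rewrite mnmE /= inordK // ltnS -dm mdeg2 leq_addr.
Qed.

Lemma monK d (i : 'I_d.+1) : exp0 d (mon i) = i.
Proof. by apply: mon_inj; rewrite exp0K ?mdeg_mon. Qed.

Definition form d (v : 'rV[R]_d.+1) : {mpoly R[2]} :=
  \sum_i v 0 i *: 'X_[mon i].

Definition coefs d f : 'rV[R]_d.+1 := \row_i f@_(mon i).

Lemma form_is_linear d : linear (@form d).
Proof.
move=> c u v; rewrite /form scaler_sumr -big_split; apply: eq_bigr => i _ /=.
by rewrite !mxE scalerDl scalerA.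
Qed.

HB.instance Definition _ d :=
  GRing.isLinear.Build R 'rV[R]_d.+1 {mpoly R[2]} _ (@form d)
    (@form_is_linear d).

Lemma coefs_is_linear d : linear (@coefs d).
Proof. by move=> c f g; apply/rowP=> i; rewrite !mxE mcoeffD mcoeffZ. Qed.

HB.instance Definition _ d :=
  GRing.isLinear.Build R {mpoly R[2]} 'rV[R]_d.+1 _ (@coefs d)
    (@coefs_is_linear d).

Lemma mcoeff_form d (v : 'rV_d.+1) (i : 'I_d.+1) : (form v)@_(mon i) = v 0 i.
Proof.
rewrite raddf_sum /= (bigD1 i) //= mcoeffZ mcoeffX eqxx mulr1 big1 ?addr0 //.
move=> j ne; rewrite mcoeffZ mcoeffX [_ == _](negbTE _) ?mulr0 //.
by rewrite (inj_eq (@mon_inj d)).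
Qed.

Lemma coefsK d (v : 'rV_d.+1) : coefs d (form v) = v.
Proof. by apply/rowP=> i; rewrite mxE mcoeff_form. Qed.

Lemma form_homog d (v : 'rV_d.+1) : form v \is d.-homog.
Proof.
by apply: rpred_sum => i _; apply: rpredZ; rewrite dhomogX; apply/eqP/mdeg_mon.
Qed.

Lemma mcoeff_pihomog d f m :
  (pihomog mdeg d f)@_m = if mdeg m == d then f@_m else 0.
Proof.
rewrite {2}[f]mpolyE /pihomog !raddf_sum /= big_mkcond /=.
have E k : ('X_[k] : {mpoly R[2]})@_m = (k == m)%:R by rewrite mcoeffX.
case: eqP => [dm|/eqP/negbTE ndm]; last rewrite big1 //; first apply: eq_bigr.
  move=> k _; rewrite mcoeffZ E; case: (eqVneq k m) => [->|ne].
    by rewrite dm eqxx.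
  by rewrite mulr0 if_same.
move=> k _; rewrite mcoeffZ E; case: (eqVneq k m) => [->|ne].
  by rewrite ndm.
by rewrite mulr0 if_same.
Qed.

Lemma pihomog_form d f : pihomog mdeg d f = form (coefs d f).
Proof.
apply/mpolyP=> m; rewrite mcoeff_pihomog; case: eqP => [dm|ndm].
  by rewrite -(exp0K dm) mcoeff_form mxE.
rewrite raddf_sum big1 //= => i _; rewrite mcoeffZ mcoeffX.
by case: eqP => [e|]; rewrite ?mulr0 //; case: ndm; rewrite -e mdeg_mon.
Qed.

Lemma form_coefs d f : f \is d.-homog -> form (coefs d f) = f.
Proof. by move=> fd; rewrite -pihomog_form pihomog_dE. Qed.

Lemma pihomogXM d (m : 'X_{1..2}) f :
  pihomog mdeg d ('X_[m] * f) =
  if (mdeg m <= d)%N then 'X_[m] * pihomog mdeg (d - mdeg m) f else 0.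
Proof.
rewrite {1}[f]mpolyE mulr_sumr linear_sum /=.
have E k : pihomog mdeg d ('X_[m] * (f@_k *: 'X_[k])) =
  if (mdeg k + mdeg m)%N == d then f@_k *: ('X_[m] * 'X_[k]) else 0.
  rewrite addnC -mdegD -scalerAr linearZ /= -mpolyXD pihomogX.
  by case: ifP; rewrite ?scaler0.
rewrite (eq_bigr _ (fun k _ => E k)) /pihomog -big_mkcond /=; case: leqP => le.
  rewrite mulr_sumr; apply: eq_big => [k|k _]; last by rewrite scalerAr.
  by rewrite -(eqn_add2r (mdeg m) (mdeg k)) subnK.
rewrite big1 // => k /eqP e; move: le; rewrite -e.
by rewrite ltnNge leq_addl.
Qed.

Section Ideals.
Variables (I : subset2 R) (idI : is_ideal I).

Lemma ideal0 : I 0. Proof. by case: idI. Qed.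
Lemma idealD f g : I f -> I g -> I (f + g).
Proof. by case: idI => _ + _; apply. Qed.
Lemma idealM f g : I g -> I (f * g).
Proof. by case: idI => _ _; apply. Qed.
Lemma idealZ c f : I f -> I (c *: f).
Proof. by rewrite -mul_mpolyC; apply: idealM. Qed.
Lemma idealB f g : I f -> I g -> I (f - g).
Proof. by move=> If Ig; rewrite -scaleN1r; apply/idealD/idealZ. Qed.
Lemma ideal_sum (J : Type) (r : seq J) (P : pred J) (F : J -> {mpoly R[2]}) :
  (forall j, P j -> I (F j)) -> I (\sum_(j <- r | P j) F j).
Proof. by move=> IF; apply: big_ind => //; [apply: ideal0|apply: idealD]. Qed.

End Ideals.

End Coordinates.

(** * Extension of scalars *)

Section Extension.
Variables (A B : comNzRingType) (phi : {rmorphism A -> B}) (I : subset2 A).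
Hypothesis idI : is_ideal I.
Local Notation J := (extend_ideal phi I).

Lemma map_mpoly_form d (v : 'rV[A]_d.+1) :
  map_mpoly phi (form v) = form (map_mx phi v).
Proof.
rewrite /form raddf_sum /=; apply: eq_bigr => i _.
by rewrite map_mpolyZ map_mpolyX mxE.
Qed.

Lemma coefs_map_mpoly d (f : {mpoly A[2]}) :
  coefs d (map_mpoly phi f) = map_mx phi (coefs d f).
Proof. by apply/rowP=> i; rewrite !mxE mcoeff_map_mpoly. Qed.

Lemma pihomog_map_mpoly d (f : {mpoly A[2]}) :
  pihomog mdeg d (map_mpoly phi f) = map_mpoly phi (pihomog mdeg d f).
Proof. by rewrite !pihomog_form coefs_map_mpoly map_mpoly_form. Qed.

Lemma extend_ideal_mem c f : I f -> J (c *: map_mpoly phi f).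
Proof.
move=> If; exists 1, (fun _ => c%:MP), (fun _ => f); split=> //.
by rewrite big_ord1 mul_mpolyC.
Qed.

Lemma is_ideal_extend : is_ideal J.
Proof.
split.
- exists 0, (fun _ => 0), (fun _ => 0); split; last by rewrite big_ord0.
  by move=> _; apply: ideal0.
- move=> _ _ [n [b [f [If ->]]]] [n' [b' [f' [If' ->]]]].
  exists (n + n')%N.
  exists (fun i => match split i with inl j => b j | inr j => b' j end).
  exists (fun i => match split i with inl j => f j | inr j => f' j end).
  split=> [i|]; first by case: split.
  rewrite big_split_ord /=; congr (_ + _); apply: eq_bigr => i _.
    by rewrite (unsplitK (inl i)).
  by rewrite (unsplitK (inr i)).
move=> g _ [n [b [f [If ->]]]]; exists n, (fun i => g * b i), f; split=> //.
by rewrite mulr_sumr; apply: eq_bigr => i _; rewrite mulrA.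
Qed.

(** The extension of an ideal is already spanned over [B] by the images of its
elements: a polynomial coefficient splits into terms, and the monomial of a
term can be absorbed into the element of [I]. *)
Lemma extend_ideal_ind (P : {mpoly B[2]} -> Prop) :
    P 0 -> (forall f g, P f -> P g -> P (f + g)) ->
    (forall c f, I f -> P (c *: map_mpoly phi f)) ->
  forall g, J g -> P g.
Proof.
move=> P0 PD PI _ [n [b [f [If ->]]]].
apply: (big_ind P) => // i _; rewrite [b i]mpolyE mulr_suml.
apply: (big_ind P) => // m _.
rewrite -scalerAl -(map_mpolyX phi) -rmorphM /=.
exact/PI/(idealM idI).
Qed.

Lemma is_homogeneous_extend : is_homogeneous I -> is_homogeneous J.
Proof.
move=> homI d g; apply: (@extend_ideal_ind (fun g => J (pihomog mdeg d g))).
- by rewrite pihomog0; apply: (ideal0 is_ideal_extend).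
- by move=> f {}g Jf Jg; rewrite pihomogD; apply: (idealD is_ideal_extend).
move=> c f If; rewrite linearZ /= pihomog_map_mpoly.
exact/extend_ideal_mem/homI.
Qed.

End Extension.

Lemma extend_ideal_id (A : comNzRingType) (I : subset2 A) :
  is_ideal I -> forall f, extend_ideal (idfun : {rmorphism A -> A}) I f <-> I f.
Proof.
have E (f : {mpoly A[2]}) : map_mpoly idfun f = f.
  by apply/mpolyP => m; rewrite mcoeff_map_mpoly.
move=> idI f; split=> [|If]; last first.
  by rewrite -[f]E -[map_mpoly _ _]scale1r; apply: extend_ideal_mem.
apply: extend_ideal_ind => //.
- exact: (ideal0 idI).
- exact: (idealD idI).
by move=> c g Ig; rewrite E; apply: (idealZ idI).
Qed.

(** * Matrices presenting the graded parts *)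

(** [M] is the matrix, in the monomial basis and some basis of the target, of the
quotient map from forms of degree [d] onto the degree-[d] part of the quotient
ring by [I]. *)
Definition presents (F : fieldType) (I : subset2 F) d r (M : 'M[F]_(d.+1, r)) :=
  row_full M /\ forall v, I (form v) <-> v *m M = 0.

Section LocalizedBasis.
Variables (A : comNzRingType) (I : subset2 A) (d r : nat) (s : A).
Variable e : 'I_r -> {mpoly A[2]}.
Hypotheses (idI : is_ideal I) (homI : is_homogeneous I).
Hypothesis basis_e : localized_basis I d s e.

Let E : 'M[A]_(r, d.+1) := \matrix_(j < r) coefs d (e j).

Lemma form_mulE (c : 'rV_r) : form (c *m E) = \sum_(j < r) c 0 j *: e j.
Proof.
have [homE _ _] := basis_e.
rewrite mulmx_sum_row linear_sum; apply: eq_bigr => j _.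
by rewrite linearZ /= rowK form_coefs.
Qed.

(** After multiplication by a common power of [s], row [i] of [C] holds the
coordinates of the [i]-th monomial on the localized basis. *)
Lemma coordinate_matrix : exists (K : nat) (C : 'M[A]_(d.+1, r)),
  forall v : 'rV_d.+1, I (form (s ^+ K *: v - v *m C *m E)).
Proof.
have [homE spanE _] := basis_e.
have /fin_all_exists [k] i := spanE _ (form_homog (delta_mx 0 i : 'rV_d.+1)).
move=> /fin_all_exists [c Ic].
pose K := (\sum_i k i)%N.
exists K, (\matrix_(i, j) (s ^+ (K - k i) * c i j)) => v.
have -> :
  form (s ^+ K *: v - v *m (\matrix_(i, j) (s ^+ (K - k i) * c i j)) *m E)
  = \sum_i (v 0 i * s ^+ (K - k i)) *:
      (s ^+ k i *: form (delta_mx 0 i) - \sum_(j < r) c i j *: e j).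
  rewrite -mulmxA [in LHS]mulmx_sum_row {1}[v]row_sum_delta.
  rewrite scaler_sumr -sumrB linear_sum; apply: eq_bigr => i _.
  rewrite linearB !linearZ /= scalerBr scalerN !scalerA.
  have leK : (k i <= K)%N by rewrite /K (bigD1 i) //= leq_addr.
  congr (_ *: _ - _); first by rewrite -mulrA -exprD subnK // mulrC.
  rewrite -scalerA; congr (_ *: _).
  rewrite row_mul form_mulE scaler_sumr; apply: eq_bigr => j _.
  by rewrite !mxE scalerA.
by apply: (ideal_sum idI) => i _; apply: (idealZ idI).
Qed.

(** The point is that [C] is chosen before the field: it presents the fiber of
[I] at every point of D(s) simultaneously. The image of [C] is the true
coordinate matrix up to the power of [s], which becomes a unit. *)
Lemma localized_basis_extend : exists C : 'M[A]_(d.+1, r),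
  forall (F : fieldType) (phi : {rmorphism A -> F}),
    phi s != 0 -> presents (extend_ideal phi I) (map_mx phi C).
Proof.
have [K [C IC]] := coordinate_matrix.
have [homE _ freeE] := basis_e.
exists C => F phi s_neq0; set M := map_mx phi C.
(* A relation between the basis elements dies at every point of D(s). *)
have kill (c : 'rV_r) : I (form (c *m E)) -> map_mx phi c = 0.
  rewrite form_mulE => /freeE[k sc0]; apply/rowP=> j; rewrite !mxE.
  have /eqP := congr1 phi (sc0 j); rewrite rmorphM rmorphXn rmorph0 mulf_eq0.
  by rewrite expf_eq0 (negbTE s_neq0) andbF => /eqP.
have imI (v : 'rV_d.+1) : I (form v) -> map_mx phi v *m M = 0.
  move=> Iv; rewrite -map_mxM; apply: kill.
  rewrite -[form _](subKr (form (s ^+ K *: v))); apply: (idealB idI).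
    by rewrite linearZ; apply: (idealZ idI).
  by rewrite -linearB; apply: IC.
have EM : map_mx phi E *m M = (phi s ^+ K)%:M.
  apply/row_matrixP=> j; apply/eqP; rewrite eq_sym -subr_eq0; apply/eqP.
  rewrite row_mul -map_row [row j _%:M]rowE mul_mx_scalar -rmorphXn.
  rewrite -(map_delta_mx phi) -map_mxZ -map_mxM -map_mxB; apply: kill.
  by rewrite mulmxBl -scalemxAl -rowE; apply: IC.
have JI := is_ideal_extend phi idI.
split.
  apply/row_fullP; exists ((phi s ^- K) *: map_mx phi E).
  by rewrite -scalemxAl EM scale_scalar_mx mulVf // expf_neq0.
move=> v; split=> [|vM].
  rewrite -[v in v *m _]coefsK.
  apply: (@extend_ideal_ind _ _ _ _ idI (fun g => coefs d g *m M = 0)).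
  - by rewrite raddf0 mul0mx.
  - by move=> f g fM gM; rewrite raddfD mulmxDl fM gM addr0.
  move=> c f If; rewrite linearZ /= -scalemxAl coefs_map_mpoly imI ?scaler0 //.
  by rewrite -pihomog_form; apply: homI.
(* As [v *m M = 0], the form of [v] is, up to a unit, the combination with
   coefficients [v] of the relations given by [coordinate_matrix]. *)
suff: extend_ideal phi I (phi s ^+ K *: form v).
  move/(idealZ JI (phi s ^- K)).
  by rewrite scalerA mulVf ?expf_neq0 // scale1r.
have -> : phi s ^+ K *: form v =
    \sum_i v 0 i *: map_mpoly phi
      (form (s ^+ K *: delta_mx 0 i - delta_mx 0 i *m C *m E)).
  transitivity (form (phi s ^+ K *: v - v *m M *m map_mx phi E)).
    by rewrite vM mul0mx subr0 linearZ.
  rewrite {1 2}[v]row_sum_delta !mulmx_suml scaler_sumr -sumrB linear_sum.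
  apply: eq_bigr => i _; rewrite map_mpoly_form map_mxB map_mxZ rmorphXn.
  rewrite !map_mxM map_delta_mx -!scalemxAl scalerA mulrC -scalerA -scalerBr.
  by rewrite linearZ.
by apply: (ideal_sum JI) => i _; apply: extend_ideal_mem; apply: IC.
Qed.

End LocalizedBasis.

Lemma presents_locally_free (F : fieldType) (I : subset2 F) d r
    (M : 'M[F]_(d.+1, r)) :
  is_ideal I -> presents I M -> locally_free_rank I d r.
Proof.
move=> idI [/row_fullP[N NM] IM].
exists 1, (fun _ => 1), (fun _ => 1); split=> [|_].
  by rewrite big_ord1 mulr1.
exists (fun j => form (row j N)).
have sumE (c : 'I_r -> F) :
    \sum_j c j *: form (row j N) = form ((\row_j c j) *m N).
  rewrite mulmx_sum_row linear_sum; apply: eq_bigr => j _.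
  by rewrite linearZ /= mxE.
split=> [j|f fd|c]; first exact: form_homog.
  exists 0, (fun j => (coefs d f *m M) 0 j); rewrite sumE expr1n scale1r.
  rewrite -{1}(form_coefs fd) -linearB; apply/IM.
  rewrite mulmxBl -mulmxA NM mulmx1; apply/eqP; rewrite subr_eq0; apply/eqP.
  by apply/rowP=> j; rewrite !mxE.
rewrite sumE => /IM; rewrite -mulmxA NM mulmx1 => c0.
exists 0 => j; rewrite expr1n mul1r.
by have := congr1 (fun v : 'rV_r => v 0 j) c0; rewrite !mxE.
Qed.

Section PointsOverRings.
Variables (h : nat -> nat) (A : comNzRingType) (I : subset2 A).
Hypothesis ptI : hilb_point h I.

(** The spectrum of a field is a point, so one of the basic open sets of the
trivializing cover contains its image. *)
Lemma hilb_point_local (F : fieldType) (phi : {rmorphism A -> F}) d :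
  exists (s : A) (C : 'M[A]_(d.+1, h d)), phi s != 0 /\
    forall (F' : fieldType) (phi' : {rmorphism A -> F'}),
      phi' s != 0 -> presents (extend_ideal phi' I) (map_mx phi' C).
Proof.
have [idI homI /(_ d) [n [s [a [sum1 bas]]]]] := ptI.
have [i si] : exists i, phi (s i) != 0.
  apply/existsP; apply: contraT; rewrite negb_exists => /forallP s0.
  have /eqP := congr1 phi sum1; rewrite rmorph1 rmorph_sum big1 => [|i _].
    by rewrite eq_sym oner_eq0.
  by move: (s0 i); rewrite negbK rmorphM => /eqP ->; rewrite mulr0.
have [e eI] := bas i.
have [C CP] := localized_basis_extend idI homI eI.
by exists (s i), C.
Qed.

Lemma hilb_point_extend (F : fieldType) (phi : {rmorphism A -> F}) :
  hilb_point h (extend_ideal phi I).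
Proof.
have [idI homI _] := ptI.
split; first exact: is_ideal_extend; first exact: is_homogeneous_extend.
move=> d; have [s [C [s0 CP]]] := hilb_point_local phi d.
exact: presents_locally_free (is_ideal_extend phi idI) (CP F phi s0).
Qed.

End PointsOverRings.

Lemma hilb_point_presents h (F : fieldType) (I : subset2 F) d :
  hilb_point h I -> exists M : 'M_(d.+1, h d), presents I M.
Proof.
move=> ptI; have [idI _ _] := ptI.
have [s [C [s0 /(_ F idfun s0)[fC IC]]]] :=
  hilb_point_local ptI (idfun : {rmorphism F -> F}) d.
by exists (map_mx idfun C); split=> // v; rewrite -IC extend_ideal_id.
Qed.

(** * Uniformity as nonvanishing of maximal minors *)

Lemma ex_minimal_subset (T : finType) (P : {set T} -> Prop) (C : {set T}) :
  P C -> exists D : {set T},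
    [/\ P D, D \subset C & forall D', P D' -> D' \subset D -> D' = D].
Proof.
have [n] := ubnP #|C|; elim: n C => // n IHn C /ltnSE leCn PC.
have [[D PD ltDC]|minC] := classic (exists2 D, P D & D \proper C).
  have [E [PE sED minE]] := IHn D (leq_trans (proper_card ltDC) leCn) PD.
  by exists E; split=> //; apply: subset_trans sED (proper_sub ltDC).
exists C; split=> // D PD sDC; apply/eqP; rewrite eqEproper sDC /=.
by apply/negP=> ltDC; apply: minC; exists D.
Qed.

Lemma ex_enumeration (T : finType) (E : {set T}) n : #|E| = n ->
  exists2 g : 'I_n -> T, injective g & E = [set g i | i : 'I_n].
Proof.
move=> <-; exists enum_val; first exact: enum_val_inj.
apply/setP=> x; apply/idP/imsetP=> [xE|[i _ ->]]; last exact: enum_valP.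
by exists (enum_rank_in xE x); rewrite ?enum_rankK_in.
Qed.

Lemma ex_superset_card (T : finType) (E : {set T}) n :
  (#|E| <= n <= #|T|)%N -> exists2 E' : {set T}, E \subset E' & #|E'| = n.
Proof.
case/andP=> leEn lenT.
have /card_geqP[s [uniq_s size_s sE]] : (n - #|E| <= #|~: E|)%N.
  by rewrite [#|~: E|]cardsCs setCK leq_sub2r.
exists (E :|: [set x in s]); first exact: subsetUl.
rewrite cardsU [E :&: _](_ : _ = set0).
  by rewrite cards0 subn0 cardsE (card_uniqP uniq_s) size_s subnKC.
apply/setP=> x; rewrite !inE andbC; case: (boolP (x \in s)) => // /sE.
by rewrite inE => /negbTE.
Qed.

(** Multiplication by [rowsub f 1%:M] moves coordinate [i] to coordinate [f i].
It serves to view a vector indexed by a set of monomials as a form with support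
in this set, and to multiply a form by a variable. *)
Lemma scatter_row (F : fieldType) m n (f : 'I_n -> 'I_m) (w : 'rV[F]_n) j :
  (w *m rowsub f 1%:M) 0 j = \sum_(i | f i == j) w 0 i.
Proof.
rewrite mxE [RHS]big_mkcond; apply: eq_bigr => i _; rewrite !mxE.
by case: eqP => _; rewrite ?mulr1 ?mulr0.
Qed.

Lemma scatterK (F : fieldType) m n (f : 'I_n -> 'I_m) :
  injective f -> forall (w : 'rV[F]_n) i, (w *m rowsub f 1%:M) 0 (f i) = w 0 i.
Proof.
move=> inj_f w i; rewrite scatter_row (bigD1 i) //= big1 ?addr0 // => k.
by case/andP=> /eqP/inj_f ->; rewrite eqxx.
Qed.

Section Matroid.
Variables (F : fieldType) (I : subset2 F) (d r : nat) (M : 'M[F]_(d.+1, r)).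
Hypothesis presM : presents I M.

Lemma presents_leq : (r <= d.+1)%N.
Proof. by have [/eqP fM _] := presM; have := rank_leq_row M; rewrite fM. Qed.

Definition Mon_exp0 (m : Mon d) : 'I_d.+1 := exp0 d (val (val m)).

Lemma Mon_exp0K (m : Mon d) : mon (Mon_exp0 m) = val (val m).
Proof. by apply: exp0K; apply/eqP/(valP m). Qed.

Lemma mon_bound (i : 'I_d.+1) : (mdeg (mon i) < d.+1)%N.
Proof. by rewrite mdeg_mon. Qed.

Definition Mon_mon (i : 'I_d.+1) : Mon d :=
  exist (fun m : 'X_{1..2 < d.+1} => mdeg m == d)
    (BMultinom (mon_bound i)) (introT eqP (mdeg_mon i)).

Lemma Mon_monK : cancel Mon_mon Mon_exp0.
Proof. by move=> i; apply: monK. Qed.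

Lemma Mon_exp0_bij : bijective Mon_exp0.
Proof.
exists Mon_mon; last exact: Mon_monK.
by move=> m; do 2!apply: val_inj; apply: Mon_exp0K.
Qed.

Lemma card_Mon : #|Mon d| = d.+1.
Proof. by rewrite (bij_eq_card Mon_exp0_bij) card_ord. Qed.

Lemma in_support_form (v : 'rV[F]_d.+1) (m : Mon d) :
  (m \in support_in d (form v)) = (v 0 (Mon_exp0 m) != 0).
Proof. by rewrite inE mcoeff_msupp -Mon_exp0K mcoeff_form. Qed.

(** Circuits are minimal supports, and every support contains a minimal one. *)
Lemma independent_form (E : {set Mon d}) :
  independent (@circuit F I d) E <->
  forall v, v *m M = 0 -> support_in d (form v) \subset E -> v = 0.
Proof.
have [_ IM] := presM.
split=> [indE v vM vE|indE C [[f [If fd f0 <-]] _]]; last first.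
  apply/negP=> fE; move: f0; rewrite -(form_coefs fd).
  rewrite (indE (coefs d f)) ?raddf0 ?eqxx ?form_coefs //.
  by apply/IM; rewrite form_coefs.
apply: NNPP => v0.
have : is_support I (support_in d (form v)).
  exists (form v); split=> //; [exact/IM|exact: form_homog|].
  by apply/eqP=> fv0; apply: v0; rewrite -[v]coefsK fv0 raddf0.
move=> /ex_minimal_subset[C [suppC sCv minC]].
by have /negP[] := indE C (conj suppC minC); apply: subset_trans sCv vE.
Qed.

Lemma independent_row_free n (g : 'I_n -> Mon d) : injective g ->
  independent (@circuit F I d) [set g i | i : 'I_n] <->
  row_free (rowsub (Mon_exp0 \o g) M).
Proof.
move=> inj_g; rewrite independent_form; set f := Mon_exp0 \o g.
have inj_f : injective f := inj_comp (bij_inj Mon_exp0_bij) inj_g.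
have scatter_mul w : w *m rowsub f 1%:M *m M = w *m rowsub f M.
  by rewrite -mulmxA mul_rowsub_mx mul1mx.
split=> [indg|freeM v vM /subsetP vg].
  apply: inj_row_free => w wM; rewrite -scatter_mul in wM.
  apply/rowP=> i; rewrite -(scatterK inj_f w) (indg _ wM) ?mxE //.
  apply/subsetP=> m; rewrite in_support_form scatter_row.
  case: (pickP (fun i => f i == Mon_exp0 m)) => [k /eqP fk _|no_k].
    by apply/imsetP; exists k => //; apply/esym/(bij_inj Mon_exp0_bij).
  by rewrite big_pred0 ?eqxx.
have v_scatter : v = (\row_i v 0 (f i)) *m rowsub f 1%:M.
  apply/rowP=> j; have [m ->] : exists m, j = Mon_exp0 m.
    by exists (Mon_mon j); rewrite Mon_monK.
  have [/imsetP[i _ ->]|m_notin] := boolP (m \in [set g i | i : 'I_n]).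
    by rewrite [RHS](scatterK inj_f _) mxE.
  have := contra (vg m) m_notin; rewrite in_support_form negbK => /eqP ->.
  rewrite scatter_row big_pred0 // => k.
  apply: contraNF m_notin => /eqP/(bij_inj Mon_exp0_bij) <-.
  exact: imset_f.
suff w0 : \row_i v 0 (f i) = 0 by rewrite v_scatter w0 mul0mx.
by apply: (row_free_inj freeM); rewrite /= mul0mx -scatter_mul -v_scatter.
Qed.

(** Sets of more than [r] monomials are dependent because [M] has only [r]
columns, and sets of fewer than [r] monomials are not maximal once every set of
[r] monomials is independent. *)
Lemma uniform_matroid_minors :
  uniform_matroid (@circuit F I d) r <->
  forall g : {ffun 'I_r -> Mon d}, injective g ->
    \det (rowsub (Mon_exp0 \o g) M) != 0.
Proof.
have det_indep (g : 'I_r -> Mon d) : injective g ->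
    independent (@circuit F I d) [set g i | i : 'I_r] <->
    \det (rowsub (Mon_exp0 \o g) M) != 0.
  by move/independent_row_free->; rewrite row_free_unit unitmxE unitfE.
have indep_le (E : {set Mon d}) :
    independent (@circuit F I d) E -> (#|E| <= r)%N.
  have [g inj_g defE] := ex_enumeration (erefl #|E|).
  rewrite {1}defE (independent_row_free inj_g) -row_leq_rank => leE.
  exact: leq_trans leE (rank_leq_col _).
split=> [unif g inj_g|minors E].
  apply/(det_indep g inj_g); have [] // := (unif [set g i | i : 'I_r]).2 _.
  by rewrite card_imset ?card_ord.
have indep_eq (E' : {set Mon d}) :
    #|E'| = r -> independent (@circuit F I d) E'.
  case/ex_enumeration=> g inj_g ->; apply/(det_indep g inj_g).
  have inj_g' : injective (finfun g).
    by move=> i j; rewrite !ffunE; apply: inj_g.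
  have := minors _ inj_g'; congr (\det _ != 0).
  by apply/matrixP=> i j; rewrite !mxE /= ffunE.
split=> [[indE maxE]|rE].
  have [|E' sEE' rE'] := @ex_superset_card _ E r; last first.
    by rewrite -(maxE E' (indep_eq _ rE') sEE').
  by rewrite indep_le //= card_Mon presents_leq.
split=> [|E' indE' sEE']; first exact: indep_eq.
by apply/esym/eqP; rewrite eqEcard sEE' rE indep_le.
Qed.
End Matroid.

(** * Hilbert functions of ideals in two variables *)

Lemma form_lift (R : comNzRingType) d (k : 'I_d.+2) (u : 'X_{1..2})
    (v : 'rV[R]_d.+1) :
    (forall i, mon (lift k i) = (u + mon i)%MM) ->
  form (v *m rowsub (lift k) 1%:M) = 'X_[u] * form v.
Proof.
move=> monE; rewrite mulmx_sum_row linear_sum mulr_sumr.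
apply: eq_bigr => i _; rewrite linearZ /= row_rowsub row1 -scalerAr.
rewrite -mpolyXD -monE; congr (_ *: _).
rewrite /form (bigD1 (lift k i)) //= big1 ?addr0 => [|j /negbTE ne].
  by rewrite mxE !eqxx scale1r.
by rewrite mxE ne andbF scale0r.
Qed.

Lemma mon_lift0 d (i : 'I_d.+1) : mon (lift ord0 i) = (U_(ord0) + mon i)%MM.
Proof.
apply: mnm2P; first by rewrite mdegD mdeg1 !mdeg_mon.
by rewrite mnmDE mnm1E !mnmE.
Qed.

Lemma mon_lift_max d (i : 'I_d.+1) :
  mon (lift ord_max i) = (U_(ord_max) + mon i)%MM.
Proof.
apply: mnm2P; first by rewrite mdegD mdeg1 !mdeg_mon.
by rewrite mnmDE mnm1E !mnmE lift_max.
Qed.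

Lemma row_free_rowsub1 (F : fieldType) m n (f : 'I_n -> 'I_m) :
  injective f -> row_free (rowsub f 1%:M : 'M[F]_(n, m)).
Proof.
move=> inj_f; apply: inj_row_free => w w0; apply/rowP=> i.
by rewrite -(scatterK inj_f w) w0 !mxE.
Qed.

(** Let [V] be the space of forms of degree [d] in [I]. If [r < r'], then the
space of forms of degree [d.+1] in [I] has dimension at most that of [V], so it
coincides with x V, and y V is contained in x V. Then every element of [V] is
divisible by x, with quotient times y again in [V]; iterating, it is divisible
by every power of x, so [V = 0]. *)
Lemma presents_mul_closed (F : fieldType) (I : subset2 F) d r r'
    (M : 'M[F]_(d.+1, r)) (M' : 'M[F]_(d.+2, r')) :
  is_ideal I -> presents I M -> presents I M' -> r != d.+1 -> (r' <= r)%N.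
Proof.
move=> idI pM pM' r_neq.
have le_r := presents_leq pM; have le_r' := presents_leq pM'.
have [/eqP rkM IM] := pM; have [/eqP rkM' IM'] := pM'.
have shift (k : 'I_d.+2) u : (forall i, mon (lift k i) = (u + mon i)%MM) ->
    (kermx M *m rowsub (lift k) 1%:M <= kermx M')%MS.
  move=> monE; apply/sub_kermxP/row_matrixP=> i; rewrite row0 row_mul.
  apply/IM'; rewrite row_mul (form_lift _ monE); apply: (idealM idI).
  by apply/IM; rewrite -row_mul mulmx_ker row0.
rewrite leqNgt; apply/negP=> ltr.
set S0 : 'M[F]_(d.+1, d.+2) := rowsub (lift ord0) 1%:M.
set S1 : 'M[F]_(d.+1, d.+2) := rowsub (lift ord_max) 1%:M.
have sub0 : (kermx M *m S0 <= kermx M')%MS := shift _ _ (@mon_lift0 d).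
have sub1 : (kermx M *m S1 <= kermx M')%MS := shift _ _ (@mon_lift_max d).
have sub10 : (kermx M *m S1 <= kermx M *m S0)%MS.
  apply: submx_trans sub1 _; rewrite -(geq_leqif (mxrank_leqif_sup sub0)).
  rewrite mxrankMfree ?row_free_rowsub1 ?mxrank_ker ?rkM ?rkM' //; last first.
    exact: lift_inj.
  by have := leq_sub2l d.+2 ltr; rewrite subSS.
have ker_shift (v : 'rV[F]_d.+1) : (v <= kermx M)%MS ->
    exists2 w : 'rV[F]_d.+1, (w <= kermx M)%MS & v *m S1 = w *m S0.
  move=> vM; have /submxP[u uE] := submx_trans (submxMr S1 vM) sub10.
  by exists (u *m kermx M); rewrite ?submxMl // uE mulmxA.
(* Coordinate [i] is the coefficient of x^i: the relation [y v = x w] moves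
   it to coordinate [i - 1] of [w], and kills it if [i = 0]. *)
have ker0 (i : nat) : forall (v : 'rV[F]_d.+1) (lti : (i < d.+1)%N),
    (v <= kermx M)%MS -> v 0 (Ordinal lti) = 0.
  elim: i => [|i IHi] v lti /ker_shift[w wM vw];
    rewrite -(scatterK (@lift_inj _ ord_max) v) -/S1 vw scatter_row.
    by rewrite big_pred0 // => j; apply/eqP => /(congr1 val); rewrite /= /bump.
  rewrite (bigD1 (Ordinal (ltnW lti))) /=; last first.
    by apply/eqP/ord_inj; rewrite lift_max.
  rewrite big1 ?addr0 ?IHi // => j /andP[/eqP jE /eqP[]].
  by apply: ord_inj; have := congr1 (@nat_of_ord _) jE;
    rewrite lift_max /= => -[].
have : \rank (kermx M) = 0%N.
  apply/eqP; rewrite mxrank_eq0; apply/eqP/row_matrixP=> i; rewrite row0.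
  by apply/rowP=> -[j ltj]; rewrite ker0 ?row_sub // mxE.
rewrite mxrank_ker rkM => /eqP; rewrite subn_eq0 => ge_r.
by case/negP: r_neq; rewrite eqn_leq le_r ge_r.
Qed.

Lemma hilb_point_function h (F : fieldType) (I : subset2 F) :
    hilb_point h I ->
  forall e, (h e <= e.+1)%N /\
    forall d, (e <= d)%N -> h e = e.+1 \/ (h d <= h e)%N.
Proof.
move=> ptI; have [idI _ _] := ptI.
have le_h e : (h e <= e.+1)%N.
  by have [M] := hilb_point_presents e ptI; apply: presents_leq.
move=> e; split=> // d le_ed; have [->|he] := eqVneq (h e) e.+1; first by left.
have lte : (h e < e.+1)%N by rewrite ltn_neqAle he le_h.
right; elim: d le_ed => [|d IHd]; first by rewrite leqn0 => /eqP->.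
rewrite leq_eqVlt => /predU1P[->//|]; rewrite ltnS => led.
have le_hd := IHd led; apply: leq_trans (le_hd).
have [M pM] := hilb_point_presents d ptI.
have [M' pM'] := hilb_point_presents d.+1 ptI.
apply: presents_mul_closed idI pM pM' _.
by rewrite ltn_eqF // (leq_ltn_trans le_hd) // (leq_trans lte).
Qed.

Lemma eventually_0 (h : nat -> nat) :
    (exists B, forall n, (\sum_(d < n) h d <= B)%N) ->
  exists N, forall d, (N <= d)%N -> h d = 0.
Proof.
case=> B le_B; apply: NNPP => noN.
have pos n : exists2 d, (n <= d)%N & (0 < h d)%N.
  apply: NNPP => no_d; apply: noN; exists n => d led; apply/eqP.
  by rewrite -leqn0 leqNgt; apply/negP=> hd; apply: no_d; exists d.
suff [n Bn] : exists n, (B < \sum_(d < n) h d)%N.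
  by have := le_B n; rewrite leqNgt Bn.
elim: B.+1 => [|b [n bn]]; first by exists 0.
have [d led hd] := pos n; exists d.+1; rewrite big_ord_recr /=.
rewrite -addn1 leq_add // (leq_trans bn) // -(subnKC led) big_split_ord /=.
exact: leq_addr.
Qed.

(** * Ideals of forms vanishing at points *)

Section PointsIdeal.
Variables (F : fieldType) (t : F) (h : nat -> nat) (N : nat).
Hypothesis le_h : forall d, (h d <= d.+1)%N.
Hypothesis mono_h : forall e d, (e <= d)%N -> h e = e.+1 \/ (h d <= h e)%N.
Hypothesis h_eq0 : forall d, (N <= d)%N -> h d = 0.
Hypothesis inj_t : forall i j, (i < j < N)%N -> t ^+ i != t ^+ j.

(** Column [j] evaluates a form at the point (t^j : 1). *)
Definition pointsM d : 'M[F]_(d.+1, h d) :=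
  \matrix_(i < d.+1, j < h d) t ^+ (i * j).

Definition pointsI : subset2 F := fun f => forall d, coefs d f *m pointsM d = 0.

Lemma pointsM_eval d (v : 'rV[F]_d.+1) (j : 'I_(h d)) :
  (v *m pointsM d) 0 j =
    (form v).@[fun k : 'I_2 => if k == ord0 then t ^+ j else 1].
Proof.
rewrite raddf_sum mxE; apply: eq_bigr => i _ /=.
rewrite mevalZ mevalX big_ord_recr big_ord1 /= expr1n mulr1 !mxE.
by rewrite !mnmE /= -exprM mulnC.
Qed.

(** The square submatrix of the first [n] columns is a transposed Vandermonde
matrix in the powers [t ^+ g i], since t^(g i * j) = (t^(g i))^j. *)
Lemma row_free_pointsM d n (g : 'I_n -> 'I_d.+1) :
  injective g -> (n <= h d)%N -> row_free (rowsub g (pointsM d)).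
Proof.
move=> inj_g le_n; apply: inj_row_free => w w0.
pose a := \row_(i < n) t ^+ g i.
have detV : \det (Vandermonde n a) != 0.
  rewrite det_Vandermonde; apply/prodf_neq0 => i _; apply/prodf_neq0 => j ltij.
  have ltdN : (d < N)%N.
    rewrite ltnNge; apply/negP=> /h_eq0 h0; move: le_n.
    rewrite h0 leqn0 => /eqP n0.
    by case: i {ltij} => i; rewrite n0.
  have ltN (k : 'I_d.+1) : (k < N)%N := leq_trans (ltn_ord k) ltdN.
  rewrite !mxE subr_eq0; have [lt|lt|/ord_inj/inj_g eij] := ltngtP (g i) (g j).
  - by rewrite eq_sym inj_t ?lt /=.
  - by rewrite inj_t ?lt /=.
  by rewrite eij ltnn in ltij.
have /row_free_inj free_V : row_free (Vandermonde n a)^T.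
  by rewrite row_free_unit unitmx_tr unitmxE unitfE.
apply: free_V; rewrite mul0mx; apply/rowP=> j.
transitivity ((w *m rowsub g (pointsM d)) 0 (widen_ord le_n j)).
  by rewrite !mxE; apply: eq_bigr => i _; rewrite !mxE exprM.
by rewrite w0 !mxE.
Qed.

Lemma pointsI_form d (v : 'rV[F]_d.+1) :
  pointsI (form v) <-> v *m pointsM d = 0.
Proof.
split=> [/(_ d)|v0 e]; first by rewrite coefsK.
case: (eqVneq e d) => [->|ne]; first by rewrite coefsK.
rewrite [coefs e _](_ : _ = 0) ?mul0mx //; apply/rowP=> i; rewrite !mxE.
have /pihomog_dE <- := form_homog v.
by rewrite mcoeff_pihomog mdeg_mon (negbTE ne).
Qed.

Lemma pointsI_homogeneous : is_homogeneous pointsI.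
Proof. by move=> d f If; rewrite pihomog_form; apply/pointsI_form. Qed.

Lemma pointsI_low_degree d f : pointsI f -> h d = d.+1 -> coefs d f = 0.
Proof.
move=> If hd; have le_d : (d.+1 <= h d)%N by rewrite hd.
have inj_id : injective (id : 'I_d.+1 -> 'I_d.+1) by [].
have /row_free_inj := row_free_pointsM inj_id le_d.
by apply; rewrite mul0mx mxsub_id.
Qed.

(** Going up from degree [e] to degree [d], no new points are imposed when
[h d <= h e]; otherwise [h e = e.+1] points already force every form of degree
[e] in the set to be zero. *)
Lemma pointsI_ideal : is_ideal pointsI.
Proof.
have ID f g : pointsI f -> pointsI g -> pointsI (f + g).
  by move=> If Ig d; rewrite linearD mulmxDl If Ig addr0.
have I0 : pointsI 0 by move=> d; rewrite linear0 mul0mx.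
split=> // f g Ig; rewrite [f]mpolyE mulr_suml.
apply: (big_ind pointsI) => // m _ d.
rewrite -scalerAl linearZ -scalemxAl.
apply/eqP; rewrite scaler_eq0; apply/orP; right; apply/eqP/rowP=> j.
rewrite pointsM_eval -pihomog_form pihomogXM [RHS]mxE.
case: leqP => _; last by rewrite raddf0.
rewrite rmorphM /= pihomog_form; set e := (d - mdeg m)%N.
have [he|le_hde] : h e = e.+1 \/ (h d <= h e)%N by apply/mono_h/leq_subr.
  by rewrite (pointsI_low_degree Ig he) !raddf0 mulr0.
by rewrite -(pointsM_eval _ (widen_ord le_hde j)) Ig mxE mulr0.
Qed.

Lemma pointsI_presents d : presents pointsI (pointsM d).
Proof.
split; last exact: pointsI_form.
have inj_w : injective (widen_ord (le_h d)).
  by move=> i j /(congr1 val)/= /ord_inj.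
have := row_free_pointsM inj_w (leqnn _); rewrite -row_leq_rank => le_rk.
rewrite /row_full eqn_leq rank_leq_col (leq_trans le_rk) //.
by rewrite -[X in rowsub _ X]mul1mx -mul_rowsub_mx mxrankM_maxr.
Qed.

Lemma pointsI_hilb_point : hilb_point h pointsI.
Proof.
split; [exact: pointsI_ideal|exact: pointsI_homogeneous|] => d.
exact: presents_locally_free pointsI_ideal (pointsI_presents d).
Qed.

Lemma pointsI_uniform : all_matroids_uniform h pointsI.
Proof.
move=> d; apply/(uniform_matroid_minors (pointsI_presents d)) => g inj_g.
rewrite -unitfE -unitmxE -row_free_unit row_free_pointsM //.
exact: inj_comp (bij_inj (@Mon_exp0_bij d)) inj_g.
Qed.

End PointsIdeal.

(** * Existence of a scalar with distinct powers *)

Lemma distinct_powers (F : fieldType) (t : F) N :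
  t != 0 -> (forall k, (0 < k < N)%N -> t ^+ k != 1) ->
  forall i j, (i < j < N)%N -> t ^+ i != t ^+ j.
Proof.
move=> t0 t1 i j /andP[ltij ltjN]; rewrite -(subnKC (ltnW ltij)) exprD.
rewrite -[X in X != _]mulr1 (inj_eq (mulfI _)) ?expf_neq0 // eq_sym t1 //.
by rewrite subn_gt0 ltij (leq_ltn_trans (leq_subr _ _)).
Qed.

(** The excluded scalars are the roots of one nonzero polynomial. *)
Lemma infinite_distinct_powers (K : fieldType) N : infinite_type K ->
  exists t : K, forall i j, (i < j < N)%N -> t ^+ i != t ^+ j.
Proof.
move=> infK.
have big_uniq n : exists2 s : seq K, uniq s & size s = n.
  elim: n => [|n [s uniq_s <-]]; first by exists [::].
  by have [x xs] := infK s; exists (x :: s); rewrite //= xs.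
pose p : {poly K} := 'X * \prod_(k < N | (0 < k)%N) ('X^k - 1%:P).
have p0 : p != 0.
  rewrite mulf_neq0 ?polyX_eq0 //; apply/prodf_neq0 => k k0.
  by rewrite -size_poly_eq0 size_XnsubC.
have [s uniq_s size_s] := big_uniq (size p).
have /allPn[t _ pt] : ~~ all (root p) s.
  by apply/negP=> /(max_poly_roots p0)/(_ uniq_s); rewrite size_s ltnn.
exists t; move: pt; rewrite /p rootM negb_or rootX => /andP[t0 pt].
apply: distinct_powers => // k /andP[k0 ltk].
apply: contra pt => /eqP tk.
rewrite rootE horner_prod (bigD1 (Ordinal ltk)) //=.
by rewrite hornerD hornerN hornerXn hornerC tk subrr mul0r.
Qed.

Lemma transcendental_distinct_powers (K : fieldType) i j : (i < j)%N ->
  (FracField.tofrac 'X : {fraction {poly K}}) ^+ i != FracField.tofrac 'X ^+ j.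
Proof.
rewrite -!rmorphXn tofrac_eq; apply: contraTneq.
move=> /(congr1 (fun p : {poly K} => size p)).
by rewrite !size_polyXn => -[->]; rewrite ltnn.
Qed.

(** * Openness of the uniform locus *)

Lemma uniform_matroid_open h (A : comNzRingType) (I : subset2 A)
    (F : fieldType) (phi : {rmorphism A -> F}) d :
  hilb_point h I -> uniform_matroid (@circuit F (extend_ideal phi I) d) (h d) ->
  exists2 a : A, phi a != 0 &
    forall (F' : fieldType) (phi' : {rmorphism A -> F'}), phi' a != 0 ->
      uniform_matroid (@circuit F' (extend_ideal phi' I) d) (h d).
Proof.
move=> ptI unif; have [s [C [s0 CP]]] := hilb_point_local ptI phi d.
pose a := s * \prod_(g : {ffun 'I_(h d) -> Mon d} | injectiveb g)
  \det (rowsub (@Mon_exp0 d \o g) C).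
have detE (F' : fieldType) (phi' : {rmorphism A -> F'}) g :
    phi' (\det (rowsub (@Mon_exp0 d \o g) C)) =
    \det (rowsub (@Mon_exp0 d \o g) (map_mx phi' C)).
  by rewrite -det_map_mx map_mxsub.
exists a => [|F' phi'].
  rewrite rmorphM mulf_neq0 // rmorph_prod.
  apply/prodf_neq0 => g /injectiveP inj_g.
  by rewrite detE; apply: (uniform_matroid_minors (CP F phi s0)).1.
rewrite rmorphM mulf_eq0 negb_or => /andP[s'0 dets].
apply/(uniform_matroid_minors (CP F' phi' s'0)) => g /injectiveP inj_g.
by rewrite -detE; move: dets; rewrite rmorph_prod => /prodf_neq0; apply.
Qed.

Lemma uniform_matroid_rank0 (F : fieldType) (I : subset2 F) d r
    (M : 'M[F]_(d.+1, r)) :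
  presents I M -> r = 0 -> uniform_matroid (@circuit F I d) r.
Proof.
move=> pM r0; subst r; apply/(uniform_matroid_minors pM) => g _.
by rewrite det_mx00 oner_eq0.
Qed.

Lemma uniform_locus_open h (K : fieldType) (A : comNzRingType)
    (iotaA : {rmorphism K -> A}) (I : subset2 A) N :
    (forall d, (N <= d)%N -> h d = 0) -> hilb_point h I ->
  exists J : A -> Prop,
    forall (L : fieldType) (iotaL : {rmorphism K -> L})
           (phi : {rmorphism A -> L}),
      (forall c, phi (iotaA c) = iotaL c) ->
      (hilb_point h (extend_ideal phi I) /\
         all_matroids_uniform h (extend_ideal phi I) <->
       exists2 a, J a & phi a != 0).
Proof.
move=> h_eq0 ptI.
(* The largest possible equations: all elements of [A] on whose nonvanishing
   locus the matroids are uniform. *)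
exists (fun a => forall (F : fieldType) (phi : {rmorphism A -> F}),
  phi a != 0 -> all_matroids_uniform h (extend_ideal phi I)).
move=> L _ phi _; split=> [[_ unif]|[a Ja a0]]; last first.
  by split; [apply: hilb_point_extend | apply: Ja].
suff [a a0 aP] : exists2 a : A, phi a != 0 &
    forall (F : fieldType) (phi' : {rmorphism A -> F}), phi' a != 0 ->
      forall d, (d < N)%N ->
        uniform_matroid (@circuit F (extend_ideal phi' I) d) (h d).
  exists a => // F phi' a'0 d; have [led|] := leqP N d; last exact: aP.
  have [M pM] := hilb_point_presents d (hilb_point_extend ptI phi').
  exact: uniform_matroid_rank0 pM (h_eq0 d led).
elim: N {h_eq0} => [|n [a a0 aP]].
  by exists 1; rewrite ?rmorph1 ?oner_eq0.
have [b b0 bP] := uniform_matroid_open ptI (unif n).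
exists (a * b) => [|F phi']; first by rewrite rmorphM mulf_neq0.
rewrite rmorphM mulf_eq0 negb_or => /andP[a'0 b'0] d.
by rewrite ltnS leq_eqVlt => /predU1P[->|]; [apply: bP | apply: aP].
Qed.

Theorem theorem1p3 (K : fieldType) (h : nat -> nat)
    (h_sum : exists B : nat, forall n : nat, (\sum_(d < n) h d <= B)%N)
    (h_nonempty : hilb_nonempty h K) :
  exists U : point_set K,
    [/\ hilb_open h U,
        point_set_nonempty U,
        forall (L : fieldType) (iota : {rmorphism K -> L}) (I : subset2 L),
          U L iota I -> all_matroids_uniform h I
      & infinite_type K ->
        exists I : subset2 K,
          [/\ U K (idfun : {rmorphism K -> K}) I,
              hilb_point h I
            & all_matroids_uniform h I]].
Proof.
have [N h_eq0] := eventually_0 h_sum.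
have [L0 [iota0 [I0 /hilb_point_function fun_h]]] := h_nonempty.
have le_h d := (fun_h d).1; have mono_h e := (fun_h e).2.
exists (fun L _ I => hilb_point h I /\ all_matroids_uniform h I); split.
- split=> [L iota I []//|A iotaA I ptI].
  exact: (uniform_locus_open iotaA h_eq0 ptI).
- exists {fraction {poly K}}, (@FracField.tofrac {poly K} \o polyC).
  have inj_X (i j : nat) := @transcendental_distinct_powers K i j.
  exists (pointsI (FracField.tofrac 'X) h); split.
    by apply: (@pointsI_hilb_point _ _ _ N) => // i j /andP[/inj_X].
  by apply: (@pointsI_uniform _ _ _ N) => // i j /andP[/inj_X].
- by move=> L iota I [].
move=> /(@infinite_distinct_powers K N)[t inj_t]; exists (pointsI t h).
have ptI := pointsI_hilb_point le_h mono_h h_eq0 inj_t.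
by have unifI := pointsI_uniform le_h h_eq0 inj_t.
Qed.
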